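(* Let $\mathcal{W}$ be a finite vocabulary and consider the Gumbel-max watermark model described in the context, with watermark fraction $\varepsilon_n \asymp n^{-p}$ for a constant $p$ with $\frac12 < p \le 1$. Suppose Assumption (A) of the context holds. Then $H_0$ and $H_1^{\mathrm{mix}}$ merge asymptotically, i.e. the total variation distance between the joint distribution of $(Y_1,\dots,Y_n)$ under $H_0$ and under $H_1^{\mathrm{mix}}$ tends to $0$ as $n\to\infty$. Consequently, for any test based on $Y_{1:n}$, the sum of its Type I and Type II errors tends to $1$ as $n \to \infty$.
   Context: Notation: $a_n \asymp b_n$ means there are constants $C_1, C_2>0$ with $C_1 a_n \le b_n \le C_2 a_n$ for all $n$. For a probability vector $\mathbf{P}=(P_w)_{w\in\mathcal{W}}$ on the finite set $\mathcal{W}$, let $\mu_{1,\mathbf{P}}$ be the distribution on $[0,1]$ with CDF $F_{1,\mathbf{P}}(r)=\sum_{w\in\mathcal{W}} P_w r^{1/P_w}$ (terms with $P_w=0$ are $0$) and density $f_{1,\mathbf{P}}(r)=\sum_{w:P_w>0} r^{1/P_w-1}$; let $\mu_0=U(0,1)$. Watermark model: for $t=1,\dots,n$, a (random) next-token distribution $\mathbf{P}_t$ on $\mathcal{W}$ is produced, a pseudorandom vector $\xi_t=(U_{t,w})_{w\in\mathcal{W}}$ with i.i.d. $U(0,1)$ entries is available, the Gumbel-max decoder is $\mathcal{S}(\mathbf{P},\xi)=\arg\max_{w} \frac{\log U_w}{P_w}$, the observed token is $w_t$, and the pivotal statistic is $Y_t=U_{t,w_t}$. Let $\mathcal{F}_{t-1}=\sigma(\{w_j,\xi_j,\mathbf{P}_{j+1}\}_{j=1}^{t-1})$.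 Assumption (A): (a) $\xi_1,\dots,\xi_n$ are i.i.d. and $\xi_t$ is independent of $\mathcal{F}_{t-1}$; (b) with probability $\varepsilon_n$, $w_t=\mathcal{S}(\mathbf{P}_t,\xi_t)$; otherwise $w_t$ is drawn from $\mathbf{P}_t$ and, conditionally on $\mathcal{F}_{t-1}$, is independent of $\xi_t$. $H_1^{\mathrm{mix}}$ denotes the joint law of $Y_{1:n}$ generated by this model (so that $Y_t$ given $\mathbf{P}_t$ follows $(1-\varepsilon_n)\mu_0+\varepsilon_n\mu_{1,\mathbf{P}_t}$), and $H_0$ denotes the law under which $Y_1,\dots,Y_n$ are i.i.d. $U(0,1)$. Type I error: probability of rejecting $H_0$ under $H_0$; Type II error: probability of not rejecting under $H_1^{\mathrm{mix}}$. *)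

(* Defs.v *)
From mathcomp Require Import all_boot all_order all_algebra.
From mathcomp Require Import all_classical all_reals all_analysis.
Import GRing.Theory Num.Theory.

Set Implicit Arguments.
Unset Strict Implicit.
Unset Printing Implicit Defensive.

Local Open Scope classical_set_scope.
Local Open Scope ring_scope.

Section Watermark.
Context {R : realType} {W : finType} {d : measure_display} {Omega : measurableType d}.
Context {n : nat}.

(* Time indices t = 1..n are represented by t : 'I_n (i.e. 0..n-1).
   For a sample point x : Omega:
     P t x  : W -> R   is the next-token distribution P_t,
     xi t x : W -> R   is the pseudorandom vector xi_t = (U_{t,w})_w,
     w t x  : W        is the observed token w_t,
     B t x  : bool     is the (latent) coin "token t was produced by the
                       Gumbel-max decoder" (probability eps).            *)
Variables (P xi : 'I_n -> Omega -> W -> R) (w : 'I_n -> Omega -> W)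
          (B : 'I_n -> Omega -> bool).

(* Generating cylinder events of F_{t-1} (together with P_1):
   conditions on P_j for j <= t, and on w_j, xi_j for j < t (0-indexed). *)
Definition hist_event (t : 'I_n) (S : 'I_n -> set W) (A C : 'I_n -> W -> set R)
  : set Omega :=
  [set x | forall j : 'I_n,
      ((j <= t)%N -> forall a, C j a (P j x a)) /\
      ((j < t)%N -> S j (w j x) /\ forall a, A j a (xi j x a))].

Definition xi_event (t : 'I_n) (D : W -> set R) : set Omega :=
  [set x | forall a, D a (xi t x a)].

Definition Yvec (x : Omega) : n.-tuple R := [tuple xi t x (w t x) | t < n].

End Watermark.

Definition unif_rect {R : realType} {W : finType} (D : W -> set R) : \bar R :=
  (\prod_(a : W) lebesgue_measure (D a `&` `[0%R, 1%R]))%E.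

(* Gumbel-max decoder S(P, xi) = argmax_w log U_w / P_w, stated as the
   argmax relation (terms with P_w = 0 are -oo and never selected;
   ties, which have probability 0, may be broken arbitrarily). *)
Definition gumbel_argmax {R : realType} {W : finType} (Pv U : W -> R) (v : W) : Prop :=
  0 < Pv v /\ forall u : W, 0 < Pv u -> ln (U u) / Pv u <= ln (U v) / Pv v.

Definition prob_vector {R : realType} {W : finType} (Pv : W -> R) : Prop :=
  (forall a, 0 <= Pv a) /\ \sum_(a : W) Pv a = 1.

Record watermark_model {R : realType} {W : finType} {d : measure_display}
  {Omega : measurableType d} (Pr : probability Omega R) (n : nat) (eps : R)
  (P xi : 'I_n -> Omega -> W -> R) (w : 'I_n -> Omega -> W)
  (B : 'I_n -> Omega -> bool) : Prop := {
  wm_P_meas : forall t a, measurable_fun setT (fun x => P t x a);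
  wm_xi_meas : forall t a, measurable_fun setT (fun x => xi t x a);
  wm_w_meas : forall t a, measurable [set x | w t x = a];
  wm_B_meas : forall t, measurable [set x | B t x];
  wm_P_prob : forall t x, prob_vector (P t x);
  (* (A)(a): xi_t has i.i.d. U(0,1) entries and is independent of F_{t-1}
     (hence also xi_1, ..., xi_n are i.i.d.) *)
  wm_xi_indep : forall t S A C D, (forall j a, measurable (A j a)) ->
      (forall j a, measurable (C j a)) -> (forall a, measurable (D a)) ->
      Pr (hist_event P xi w t S A C `&` xi_event xi t D) =
        (Pr (hist_event P xi w t S A C) * unif_rect D)%E;
  (* (A)(b): with probability eps (independently of F_{t-1} and xi_t) ... *)
  wm_coin : forall t S A C D, (forall j a, measurable (A j a)) ->
      (forall j a, measurable (C j a)) -> (forall a, measurable (D a)) ->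
      Pr (hist_event P xi w t S A C `&` xi_event xi t D `&` [set x | B t x]) =
        (eps%:E * Pr (hist_event P xi w t S A C `&` xi_event xi t D))%E;
  wm_decoder : forall t x, B t x -> gumbel_argmax (P t x) (xi t x) (w t x);
  (* ... otherwise w_t is drawn from P_t and, conditionally on F_{t-1},
     is independent of xi_t *)
  wm_sample : forall t S A C D a, (forall j a, measurable (A j a)) ->
      (forall j a, measurable (C j a)) -> (forall a, measurable (D a)) ->
      Pr (hist_event P xi w t S A C `&` xi_event xi t D `&`
          [set x | ~~ B t x] `&` [set x | w t x = a]) =
        ((1 - eps)%:E * (\int[Pr]_(x in hist_event P xi w t S A C) (P t x a)%:E)
           * unif_rect D)%E }.

Definition iid_uniform {R : realType} (n : nat) (Q : probability (n.-tuple R) R) : Prop :=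
  forall A : 'I_n -> set R, (forall i, measurable (A i)) ->
    Q [set y | forall i, A i (tnth y i)] =
      (\prod_(i < n) lebesgue_measure (A i `&` `[0%R, 1%R]))%E.

Definition tv_dist {R : realType} {d : measure_display} {Omega : measurableType d}
  (n : nat) (Q : probability (n.-tuple R) R) (Pr : probability Omega R)
  (Y : Omega -> n.-tuple R) : \bar R :=
  ereal_sup [set `|Q A - Pr (Y @^-1` A)|%E | A in [set A | measurable A]].

(* Main.v *)
Require Import Defs.
From HB Require Import structures.
From mathcomp Require Import all_boot all_order all_algebra.
From mathcomp Require Import all_classical all_reals all_analysis.
From mathcomp Require Import measurable_realfun ring lra.
Import Order.TTheory GRing.Theory Num.Theory.
Import numFieldTopology.Exports.
Set Implicit Arguments.
Unset Strict Implicit.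
Unset Printing Implicit Defensive.
Local Open Scope classical_set_scope.
Local Open Scope ring_scope.

(** Given the past, [Y_t] is uniform with probability [1 - e], and otherwise it
    is one of the [#|W|] uniform variables [U_{t,a}]; hence its conditional law
    is [(1 - e) U + e nu] with [nu <= #|W| U].

    Fix an event [A] and let [h_k] be the conditional probability of [A] under
    the uniform law given the first [k] coordinates, so that [h_n] is the
    indicator of [A] and [h_0] is the uniform probability of [A]. Follow the
    strictly concave potential [phi v = v - c v^2] of [h_k(Y)]. With the uniform
    part alone, revealing [Y_t] lowers its mean by [c] times a conditional
    variance; the [e]-part raises it by at most [#|W| e] times a conditional
    mean absolute deviation. By AM-GM the net gain per step is [O(e^2 / c)], so
    [Pr(Y in A) - U(A) <= c + O(n e^2 / c)]; the choice [c = n^(1/2 - p)] bounds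
    the total variation distance by [O(n^(1/2 - p))]. *)

(** * Measures on tuples *)

Lemma measurable_forall_fin d (T : measurableType d) (I : finType)
    (F : I -> set T) :
  (forall i, measurable (F i)) -> measurable [set x | forall i, F i x].
Proof.
move=> mF; rewrite [X in measurable X](_ : _ = \bigcap_(i in setT) F i).
  by apply: fin_bigcap_measurable => // i _.
by apply/seteqP; split=> x /= h i => [_|]; exact: h.
Qed.

Lemma measurable_exists_fin d (T : measurableType d) (I : finType)
    (F : I -> set T) :
  (forall i, measurable (F i)) -> measurable [set x | exists i, F i x].
Proof.
move=> mF; rewrite [X in measurable X](_ : _ = \bigcup_(i in setT) F i).
  by apply: fin_bigcup_measurable => // i _.
by apply/seteqP; split=> x /= [i h]; [|move=> ?]; exists i.
Qed.

Section tuple_rect.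
Context {R : realType} {n : nat}.
Implicit Types A : 'I_n -> set R.

Definition rect A : set (n.-tuple R) := [set y | forall i, A i (tnth y i)].

Definition rects : set (set (n.-tuple R)) :=
  [set E | exists2 A, (forall i, measurable (A i)) & E = rect A].

Lemma measurable_rect A : (forall i, measurable (A i)) -> measurable (rect A).
Proof.
move=> mA; apply: measurable_forall_fin => i.
by rewrite -[X in measurable X]setTI; exact: measurable_tnth.
Qed.

Lemma measurable_tupleE : measurable = <<s rects >>.
Proof.
apply/seteqP; split; last first.
  apply: smallest_sub; first exact: sigma_algebra_measurable.
  by move=> _ [A mA ->]; exact: measurable_rect.
apply: smallest_sub; first exact: smallest_sigma_algebra.
move=> E; rewrite -bigcup_seq => -[/= i _ [B mB <-]].
apply: sub_sigma_algebra; exists (fun j => if j == i then B else setT).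
  by move=> j; case: ifP.
apply/seteqP; split=> y; rewrite setTI /=.
  by move=> By j; case: eqP => [->|].
by move=> /(_ i); rewrite eqxx.
Qed.

(** Rectangles form a pi-system that contains the whole space and generates the tuple sigma-algebra,
    so the uniqueness theorem for finite measures applies. *)
Lemma tuple_measure_unique (m1 m2 : {measure set (n.-tuple R) -> \bar R}) :
  (m1 setT < +oo)%E ->
  (forall A, (forall i, measurable (A i)) -> m1 (rect A) = m2 (rect A)) ->
  forall E, measurable E -> m1 E = m2 E.
Proof.
move=> fm1 m12 E mE.
apply: (measure_unique rects (fun=> setT)) => //.
- exact: measurable_tupleE.
- move=> _ _ [A mA ->] [B mB ->]; exists (fun i => A i `&` B i).
    by move=> i; exact: measurableI.
  by apply/seteqP; split=> y /= => [[h1 h2] i|h]; split=> // i; case: (h i).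
- by move=> _; exists (fun=> setT) => //; apply/seteqP; split.
- by rewrite bigcup_const.
- by move=> _ [A mA ->]; exact: m12.
Qed.

Definition upd (y : n.-tuple R) (t : 'I_n) (u : R) : n.-tuple R :=
  [tuple if i == t then u else tnth y i | i < n].

Lemma tnth_upd y t u i : tnth (upd y t u) i = if i == t then u else tnth y i.
Proof. exact: tnth_mktuple. Qed.

Lemma upd_id y t : upd y t (tnth y t) = y.
Proof. by apply: eq_from_tnth => i; rewrite tnth_upd; case: eqP => [->|]. Qed.

Lemma measurable_upd t :
  measurable_fun setT (fun z : n.-tuple R * R => upd z.1 t z.2).
Proof.
apply/measurable_fun_tnthP => i.
rewrite [X in measurable_fun _ X](_ : _ =
  fun z : n.-tuple R * R => if i == t then z.2 else tnth z.1 i).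
  case: eqP => _; first exact: measurable_snd.
  apply: (@measurableT_comp _ _ _ _ _ _ (fun y : n.-tuple R => tnth y i)) => //.
  exact: measurable_tnth.
by apply/funext => z /=; rewrite tnth_mktuple.
Qed.

(** Stands for measurability with respect to the first [k] coordinates. The function stays defined
    on full tuples, so that an induction on [k] never changes the space. *)
Definition depends_below (T : Type) (k : nat) (h : n.-tuple R -> T) :=
  forall y y', (forall i : 'I_n, (i < k)%N -> tnth y i = tnth y' i) -> h y = h y'.

Lemma depends_below_upd T (t : 'I_n) (k : nat) (h : n.-tuple R -> T) y u :
  (k <= t)%N -> depends_below k h -> h (upd y t u) = h y.
Proof.
move=> kt; apply=> i ik; rewrite tnth_mktuple; case: eqP => // it.
by move: ik; rewrite it ltnNge kt.
Qed.

End tuple_rect.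

(** The complement of [D] is null for the restricted measure. The right-hand side is an integral
    over the whole space, to which image measures apply. *)
Lemma ge0_integral_mrestr d (T : measurableType d) (R : realType)
    (mu : {measure set T -> \bar R}) (D : set T) (mD : measurable D)
    (f : T -> \bar R) : measurable_fun setT f -> (forall x, 0 <= f x)%E ->
  (\int[mu]_(x in D) f x = \int[mrestr mu mD]_x f x)%E.
Proof.
move=> mf f0; rewrite (eq_measure_integral (mrestr mu mD)); last first.
  by move=> A mA AD; rewrite /= /mrestr setIidl.
rewrite [RHS](ge0_negligible_integral (N := ~` D)) //.
- by rewrite setTD setCK.
- exact: measurableC.
- by rewrite /= /mrestr setICl measure0.
Qed.

(** Both sides integrate [h] against measures on tuples: the image by [Z1] of [m1] restricted to
    [D], and [k] times the image by [Z2] of [m2]. Agreement on rectangles makes these measures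
    equal. This turns independence of events into identities between integrals. *)
Lemma ge0_integral_eq_rect (R : realType) (n : nat)
    d1 (T1 : measurableType d1) d2 (T2 : measurableType d2)
    (m1 : {measure set T1 -> \bar R}) (m2 : {measure set T2 -> \bar R})
    (Z1 : T1 -> n.-tuple R) (Z2 : T2 -> n.-tuple R) (D : set T1) (k : R)
    (h : n.-tuple R -> \bar R) :
  measurable D -> measurable_fun setT Z1 -> measurable_fun setT Z2 ->
  (m1 D < +oo)%E -> 0 <= k ->
  (forall A, (forall i, measurable (A i)) ->
    m1 (Z1 @^-1` rect A `&` D) = k%:E * m2 (Z2 @^-1` rect A))%E ->
  measurable_fun setT h -> (forall y, 0 <= h y)%E ->
  (\int[m1]_(x in D) h (Z1 x) = k%:E * \int[m2]_x h (Z2 x))%E.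
Proof.
move=> mD mZ1 mZ2 fD k0 eqA mh h0.
rewrite (ge0_integral_mrestr _ mD) //; last exact: measurableT_comp.
have <- := @ge0_integral_pushforward _ _ _ _ _ _ mZ1 (mrestr m1 mD) setT h
  measurableT mh (fun y _ => h0 y).
have <- := @ge0_integral_pushforward _ _ _ _ _ _ mZ2 m2 setT h
  measurableT mh (fun y _ => h0 y).
rewrite -(@ge0_integral_mscale _ _ _ _ _ measurableT (NngNum k0)) //.
apply: eq_measure_integral => E mE _.
apply: tuple_measure_unique => //.
  by rewrite /= /pushforward /mrestr preimage_setT setTI.
Qed.

(** * The uniform law on the unit interval *)

Section unif01.
Context {R : realType}.

(* [uniform_prob] lives on [measurableTypeR R], whose display differs from that
   of the canonical structure on [R]; the identity transports it. *)
Let idTR : measurableTypeR R -> R := idfun.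

#[local] HB.instance Definition _ :=
  @isMeasurableFun.Build _ _ _ _ idTR (@measurable_id _ _ setT).

Definition unif01 : probability R R := distribution (uniform_prob (@ltr01 R)) idTR.

Lemma unif01E (D : set R) : measurable D ->
  unif01 D = lebesgue_measure (D `&` `[0%R, 1%R]).
Proof.
move=> mD; rewrite /unif01 /= /distribution /pushforward preimage_id.
rewrite /uniform_prob integral_uniform_pdf (eq_integral (fun=> 1%E)).
  by rewrite integral_cst ?mul1e//; exact: measurableI.
move=> x; rewrite inE /= in_itv /= => -[_ x01].
by rewrite /uniform_pdf x01 subr0 invr1.
Qed.

End unif01.

(** * Averaging over one coordinate *)

Section average.
Context {R : realType} {n : nat}.
Implicit Types (t : 'I_n) (y : n.-tuple R) (h : n.-tuple R -> R).

(** Under the uniform law, for measurable [h] with values in the unit interval, this is the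
    conditional expectation of [h] given all coordinates but [t]. *)
Definition avg t h y : R := fine (\int[unif01]_u (h (upd y t u))%:E).

Lemma measurable_upd_r t y : measurable_fun setT (upd y t).
Proof.
exact: (measurableT_comp (measurable_upd t)
  (measurable_fun_pair (measurable_cst y) (@measurable_id _ _ setT))).
Qed.

Lemma avgE t h y : measurable_fun setT h -> (forall y, 0 <= h y <= 1) ->
  ((avg t h y)%:E = \int[unif01]_u (h (upd y t u))%:E)%E.
Proof.
move=> mh h01; rewrite fineK// ge0_fin_numE; last first.
  by apply: integral_ge0 => u _; rewrite lee_fin; case/andP: (h01 (upd y t u)).
apply: (@le_lt_trans _ _ (\int[unif01]_(u in setT) cst 1 u)%E).
  apply: ge0_le_integral => //=.
  - by move=> u _; rewrite lee_fin; case/andP: (h01 (upd y t u)).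
  - by apply/measurable_EFinP; apply: (measurableT_comp mh); exact: measurable_upd_r.
  - by move=> u _; rewrite lee_fin; case/andP: (h01 (upd y t u)).
by rewrite integral_cst// mul1e [X in (X < _)%E]probability_setT ltry.
Qed.

Lemma avg_ge0_le1 t h y : measurable_fun setT h -> (forall y, 0 <= h y <= 1) ->
  0 <= avg t h y <= 1.
Proof.
move=> mh h01; rewrite -2!lee_fin avgE// integral_ge0 /=; last first.
  by move=> u _; rewrite lee_fin; case/andP: (h01 (upd y t u)).
rewrite -[leRHS](@probability_setT _ _ _ (@unif01 R)) -[leRHS]mul1e -integral_cst//.
apply: ge0_le_integral => //=.
- by move=> u _; rewrite lee_fin; case/andP: (h01 (upd y t u)).
- by apply/measurable_EFinP; apply: (measurableT_comp mh); exact: measurable_upd_r.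
- by move=> u _; rewrite lee_fin; case/andP: (h01 (upd y t u)).
Qed.

Lemma measurable_avg t h : measurable_fun setT h -> (forall y, 0 <= h y <= 1) ->
  measurable_fun setT (avg t h).
Proof.
move=> mh h01; apply/measurable_EFinP.
rewrite [X in measurable_fun _ X](_ : _ =
  fubini_F unif01 (fun z : n.-tuple R * R => (h (upd z.1 t z.2))%:E)); last first.
  by apply/funext => y /=; rewrite avgE.
apply: measurable_fun_fubini_tonelli_F => //=.
  by apply/measurable_EFinP; apply: (measurableT_comp mh); exact: measurable_upd.
by move=> z; rewrite lee_fin; case/andP: (h01 (upd z.1 t z.2)).
Qed.

Lemma depends_below_avg t h : depends_below t.+1 h -> depends_below t (avg t h).
Proof.
move=> dh y y' yy'; rewrite /avg; congr fine; apply: eq_integral => u _.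
congr EFin; apply: dh => i; rewrite ltnS !tnth_mktuple; case: eqP => // it ilet.
by apply: yy'; rewrite ltn_neqAle ilet andbT; apply/eqP => /val_inj.
Qed.

(** Replacing one coordinate of an i.i.d. uniform tuple by a fresh independent uniform leaves the
    law unchanged, as rectangles show. *)
Lemma integral_avg (Q : probability (n.-tuple R) R) t h :
  iid_uniform Q -> measurable_fun setT h -> (forall y, 0 <= h y <= 1) ->
  (\int[Q]_y (avg t h y)%:E = \int[Q]_y (h y)%:E)%E.
Proof.
move=> iidQ mh h01; symmetry.
have h0 y : (0 <= (h y)%:E)%E by rewrite lee_fin; case/andP: (h01 y).
have mhE : measurable_fun setT (EFin \o h) by exact/measurable_EFinP.
have -> : (\int[Q]_y (h y)%:E =
    1%:E * \int[Q \x unif01]_z (h (upd z.1 t z.2))%:E)%E.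
  apply: (@ge0_integral_eq_rect _ _ _ _ _ _ Q (Q \x unif01)%E id
    (fun z : n.-tuple R * R => upd z.1 t z.2) setT 1 (EFin \o h)) => //.
  - exact: measurable_upd.
  - by rewrite [X in (X < _)%E]probability_setT ltry.
  move=> A mA; rewrite mul1e setIT preimage_id.
  (* [upd] erases coordinate [t] of the tuple, so the constraint [A t] bears on the fresh variable
     alone. *)
  pose A' := fun i => if i == t then setT else A i.
  have mA' i : measurable (A' i) by rewrite /A'; case: eqP.
  have -> : (fun z : n.-tuple R * R => upd z.1 t z.2) @^-1` rect A = rect A' `*` A t.
    apply/seteqP; split=> -[y u] /=; rewrite /rect /A' /=.
      move=> Ay; split; last by have := Ay t; rewrite tnth_mktuple eqxx.
      by move=> i; have := Ay i; rewrite tnth_mktuple; case: eqP.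
    move=> [Ay Au] i; have := Ay i; rewrite tnth_mktuple.
    by case: eqP => [->|].
  have mrA' := measurable_rect mA'.
  rewrite [RHS]product_measure1E// [LHS](iidQ _ mA) [X in (X * _)%E](iidQ _ mA').
  rewrite [X in (_ * X)%E]unif01E//.
  rewrite (bigD1 t)//= [in RHS](bigD1 t)//= /A' eqxx setTI.
  rewrite lebesgue_measure_itv /= lte_fin ltr01 oppr0 adde0 mul1e muleC.
  by congr (_ * _)%E; apply: eq_bigr => i /negbTE ->.
rewrite mul1e fubini_tonelli1//=.
  by apply: eq_integral => y _; rewrite avgE.
by apply: (measurableT_comp mhE); exact: measurable_upd.
Qed.

End average.

(** * Conditional law of the pivotal statistics *)

Lemma unif_rect_single (R : realType) (W : finType) (a : W) (D : set R) :
  measurable D ->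
  unif_rect (fun b => if b == a then D else setT) = unif01 D.
Proof.
move=> mD; rewrite /unif_rect (bigD1 a)//= eqxx big1 ?mule1 ?unif01E//.
move=> b /negbTE ->.
by rewrite setTI lebesgue_measure_itv /= lte_fin ltr01 oppr0 adde0.
Qed.

Section model.
Context {R : realType} {W : finType} {d : measure_display}
  {Omega : measurableType d} {Pr : probability Omega R} {n : nat} {e : R}
  {P xi : 'I_n -> Omega -> W -> R} {w : 'I_n -> Omega -> W}
  {B : 'I_n -> Omega -> bool}.
Hypothesis hm : watermark_model Pr e P xi w B.
Implicit Types (t : 'I_n) (D : set R) (H : set Omega).

Local Notation Y := (Yvec xi w).
Local Notation coin t := [set x | B t x].

Lemma measurable_token t (S : set W) : measurable [set x | S (w t x)].
Proof.
rewrite [X in measurable X](_ : _ = [set x | exists b, S b /\ w t x = b]).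
  apply: measurable_exists_fin => b.
  have [Sb|Sb] := pselect (S b).
    rewrite [X in measurable X](_ : _ = [set x | w t x = b]).
      exact: (wm_w_meas hm).
    by apply/seteqP; split=> x /=; tauto.
  by rewrite [X in measurable X](_ : _ = set0)//; apply/seteqP; split=> x //= -[].
by apply/seteqP; split=> x /= => [?|[b [? ->]]//]; exists (w t x).
Qed.

Lemma measurable_xi t a D : measurable D -> measurable [set x | D (xi t x a)].
Proof.
move=> mD; rewrite -[X in measurable X]setTI.
exact: (wm_xi_meas hm).
Qed.

Lemma measurable_xi_event t (D : W -> set R) :
  (forall a, measurable (D a)) -> measurable (xi_event xi t D).
Proof. by move=> mD; apply: measurable_forall_fin => a; exact: measurable_xi. Qed.

Lemma measurable_coin t : measurable (coin t).
Proof. exact: (wm_B_meas hm). Qed.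

Lemma measurable_ncoin t : measurable [set x | ~~ B t x].
Proof.
rewrite [X in measurable X](_ : _ = ~` coin t).
  exact/measurableC/measurable_coin.
by apply/seteqP; split=> x /= /negP.
Qed.

Lemma measurable_Y_event t D : measurable D -> measurable [set x | D (tnth (Y x) t)].
Proof.
move=> mD; rewrite [X in measurable X](_ : _ =
  [set x | exists b, w t x = b /\ D (xi t x b)]).
  apply: measurable_exists_fin => b.
  exact: (measurableI _ _ (wm_w_meas hm t b) (measurable_xi t b mD)).
apply/seteqP; split=> x /=; rewrite tnth_mktuple; last by case=> b [<-].
move=> ?.
by exists (w t x).
Qed.

Lemma measurable_Yvec : measurable_fun setT Y.
Proof.
apply/measurable_fun_tnthP => t _ D mD; rewrite setTI.
exact: measurable_Y_event.
Qed.

Lemma measurable_Y_preimage (A : set (n.-tuple R)) :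
  measurable A -> measurable (Y @^-1` A).
Proof. by move=> mA; rewrite -[X in measurable X]setTI; exact: measurable_Yvec. Qed.

Lemma measurable_hist_event t (S : 'I_n -> set W) A C :
  (forall j a, measurable (A j a)) -> (forall j a, measurable (C j a)) ->
  measurable (hist_event P xi w t S A C).
Proof.
move=> mA mC; apply: measurable_forall_fin => j; apply: measurableI.
  case: (j <= t)%N.
    rewrite [X in measurable X](_ : _ = [set x | forall a, C j a (P j x a)]).
      apply: measurable_forall_fin => a; rewrite -[X in measurable X]setTI.
      exact: (wm_P_meas hm).
    by apply/seteqP; split=> x /=; auto.
  by rewrite [X in measurable X](_ : _ = setT)//; apply/seteqP; split.
case: (j < t)%N.
  rewrite [X in measurable X](_ : _ = [set x | S j (w j x)] `&`
      [set x | forall a, A j a (xi j x a)]).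
    apply: measurableI; first exact: measurable_token.
    by apply: measurable_forall_fin => a; exact: measurable_xi.
  by apply/seteqP; split=> x /=; auto.
by rewrite [X in measurable X](_ : _ = setT)//; apply/seteqP; split.
Qed.

(** * Events of the past and independence of the present *)

Definition hist_events t : set (set Omega) :=
  [set E | exists S A C, [/\ forall j a, measurable (A j a),
     forall j a, measurable (C j a) & E = hist_event P xi w t S A C]].

Lemma hist_events_measurable t : hist_events t `<=` measurable.
Proof. by move=> _ [S [A [C [mA mC ->]]]]; exact: measurable_hist_event. Qed.

Lemma setT_hist_event t : setT = hist_event P xi w t (fun=> setT)
  (fun _ _ => setT) (fun _ _ => setT).
Proof. by apply/seteqP; split. Qed.

Lemma setI_closed_hist_events t : setI_closed (hist_events t).
Proof.
move=> _ _ [S [A [C [mA mC ->]]]] [S' [A' [C' [mA' mC' ->]]]].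
exists (fun j => S j `&` S' j), (fun j a => A j a `&` A' j a),
  (fun j a => C j a `&` C' j a); split.
- by move=> j a; exact: measurableI.
- by move=> j a; exact: measurableI.
apply/seteqP; split=> x /=.
  move=> [h1 h2] j; have [a1 b1] := h1 j; have [a2 b2] := h2 j; split.
    by move=> jt a; split; [exact: a1|exact: a2].
  move=> jt; have [s1 x1] := b1 jt; have [s2 x2] := b2 jt.
  by split; [split|move=> a; split; [exact: x1|exact: x2]].
move=> h; split=> j; have [a1 b1] := h j; split.
- by move=> jt a; case: (a1 jt a).
- by move=> jt; case: (b1 jt) => -[? ?] xx; split=> // a; case: (xx a).
- by move=> jt a; case: (a1 jt a).
- by move=> jt; case: (b1 jt) => -[? ?] xx; split=> // a; case: (xx a).
Qed.

Lemma hist_measurable t H : <<s hist_events t >> H -> measurable H.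
Proof.
apply: smallest_sub; first exact: sigma_algebra_measurable.
exact: hist_events_measurable.
Qed.

(** The model speaks of cylinders only. Both sides are finite measures in [H], and the cylinders are
    a pi-system containing the whole space, so the identity extends to the sigma-algebra of the
    past. *)
Lemma hist_restr_unique t (D : set Omega) (k : R) : measurable D -> 0 <= k ->
  (forall H, hist_events t H -> Pr (H `&` D) = k%:E * Pr H)%E ->
  forall H, <<s hist_events t >> H -> (Pr (H `&` D) = k%:E * Pr H)%E.
Proof.
move=> mD k0 DH H HH.
apply: (@g_sigma_algebra_measure_unique _ R _ (hist_events t) _ (fun=> setT)
  _ _ (mrestr Pr mD) (mscale (NngNum k0) Pr)) => //.
- exact: hist_events_measurable.
- by move=> _; do 3 eexists; split; [| |exact: (setT_hist_event t)].
- by rewrite bigcup_const.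
- exact: setI_closed_hist_events.
- by move=> _; rewrite /= /mrestr setTI -ge0_fin_numE// fin_num_measure.
Qed.

Lemma coin_prob t : Pr (coin t) = e%:E.
Proof.
have := @wm_coin _ _ _ _ _ _ _ _ _ _ _ hm t (fun=> setT) (fun _ _ => setT)
  (fun _ _ => setT) (fun _ => setT).
rewrite -setT_hist_event (_ : xi_event _ _ _ = setT); last by apply/seteqP; split.
by rewrite !setTI [X in (_ * X)%E]probability_setT mule1 => ->.
Qed.

(** An index [t] is required: when [n = 0] the model does not constrain [e]. *)
Lemma coin_ge0_le1 (t : 'I_n) : 0 <= e <= 1.
Proof.
by rewrite -!lee_fin -(coin_prob t) measure_ge0 probability_le1//; exact: measurable_coin.
Qed.

(** The letter [a] is fixed, so no selection by the decoder enters: [wm_coin] splits off the coin,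
    then [wm_xi_indep] separates the entry [U_{t,a}] from the past. *)
Lemma coin_indep t a D H : measurable D -> <<s hist_events t >> H ->
  (Pr (H `&` ([set x | D (xi t x a)] `&` coin t)) = e%:E * (Pr H * unif01 D))%E.
Proof.
move=> mD HH.
have UDE : ((fine (unif01 D))%:E = unif01 D)%E by rewrite fineK// fin_num_measure.
have mE : measurable ([set x | D (xi t x a)] `&` coin t).
  by apply: measurableI; [exact: measurable_xi|exact: measurable_coin].
have k0 : 0 <= e * fine (unif01 D).
  by rewrite mulr_ge0 ?fine_ge0//; case/andP: (coin_ge0_le1 t).
rewrite (hist_restr_unique mE k0 _ HH); last first.
  move=> _ [S [A [C [mA mC ->]]]].
  pose D' b := if b == a then D else setT.
  have mD' b : measurable (D' b) by rewrite /D'; case: ifP.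
  have -> : [set x | D (xi t x a)] = xi_event xi t D'.
    apply/seteqP; split=> x /=; rewrite /xi_event /D' /=.
      by move=> Dx b; case: eqP => [->|].
    by move=> /(_ a); rewrite eqxx.
  rewrite setIA (wm_coin hm)// (wm_xi_indep hm)// unif_rect_single// EFinM UDE.
  by rewrite -muleA; congr (_ * _)%E; exact: muleC.
by rewrite EFinM UDE -muleA; congr (_ * _)%E; exact: muleC.
Qed.

Lemma disjoint_token t (F : W -> set Omega) :
  trivIset setT (fun a => F a `&` [set x | w t x = a]).
Proof. by move=> a b _ _ [x [[_ /= <-] [_ /= <-]]]. Qed.

(** Split according to the token [a]. By [wm_sample] each piece is the integral of [P_t(a)] over the
    past event times the uniform mass of [D], and the [P_t(a)] sum to one. *)
Lemma ncoin_indep t D H : measurable D -> <<s hist_events t >> H ->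
  (Pr (H `&` ([set x | D (tnth (Y x) t)] `&` [set x | ~~ B t x])) =
     (1 - e)%:E * (Pr H * unif01 D))%E.
Proof.
move=> mD HH.
have UDE : ((fine (unif01 D))%:E = unif01 D)%E by rewrite fineK// fin_num_measure.
have mE : measurable ([set x | D (tnth (Y x) t)] `&` [set x | ~~ B t x]).
  by apply: measurableI; [exact: measurable_Y_event|exact: measurable_ncoin].
have k0 : 0 <= (1 - e) * fine (unif01 D).
  by rewrite mulr_ge0 ?fine_ge0// subr_ge0; case/andP: (coin_ge0_le1 t).
rewrite (hist_restr_unique mE k0 _ HH); last first.
  move=> _ [S [A [C [mA mC ->]]]].
  set H0 := hist_event _ _ _ _ _ _ _.
  have mH0 : measurable H0 by exact: measurable_hist_event.
  pose D' (a b : W) := if b == a then D else setT.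
  have mD' a b : measurable (D' a b) by rewrite /D'; case: ifP.
  pose F a := H0 `&` xi_event xi t (D' a) `&` [set x | ~~ B t x].
  have mF a : measurable (F a `&` [set x | w t x = a]).
    apply: measurableI; last exact: (wm_w_meas hm).
    apply: measurableI; last exact: measurable_ncoin.
    by apply: measurableI => //; exact: measurable_xi_event.
  have -> : H0 `&` ([set x | D (tnth (Y x) t)] `&` [set x | ~~ B t x]) =
      \bigcup_(a in setT) (F a `&` [set x | w t x = a]).
    apply/seteqP; split=> x /=.
      move=> [Hx]; rewrite tnth_mktuple => -[Dx Bx].
      exists (w t x) => //; split=> //; split=> //; split=> // b.
      by rewrite /D'; case: eqP => [->|].
    move=> [a _ [[[Hx xix] Bx] /= wa]]; rewrite tnth_mktuple wa; split=> //.
    by split=> //; have := xix a; rewrite /D' eqxx.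
  rewrite measure_fin_bigcup//; [|exact: finite_finset|exact: disjoint_token].
  rewrite (fsbigE (index_enum W)) ?index_enum_uniq//; last first.
    by move=> a _; rewrite mem_index_enum.
  rewrite (eq_bigl predT); last by move=> a; exact: mem_set.
  pose I a := (\int[Pr]_(x in H0) (P t x a)%:E)%E.
  have P0 a x : (0 <= (P t x a)%:E)%E by rewrite lee_fin; case: (wm_P_prob hm t x).
  have I0 a : (0 <= I a)%E by apply: integral_ge0.
  rewrite (eq_bigr (fun a => ((1 - e)%:E * I a * unif01 D)%E)); last first.
    by move=> a _; rewrite [LHS](wm_sample hm)// unif_rect_single.
  rewrite -ge0_sume_distrl; last first.
    by move=> a _; rewrite mule_ge0// lee_fin subr_ge0; case/andP: (coin_ge0_le1 t).
  rewrite -ge0_sume_distrr// -ge0_integral_sum//; last first.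
    by move=> a; apply/measurable_EFinP/measurable_funTS/(wm_P_meas hm).
  rewrite (eq_integral (fun=> 1%E)); last first.
    by move=> x _; rewrite sumEFin (wm_P_prob hm t x).2.
  rewrite integral_cst// mul1e EFinM UDE -!muleA; congr (_ * _)%E; exact: muleC.
by rewrite EFinM UDE -muleA; congr (_ * _)%E; exact: muleC.
Qed.

(* Zeroing the coordinates beyond [t] makes all coordinates of [truncY t] but the
   [t]-th measurable with respect to the history before [t]. *)
Definition truncY t (x : Omega) : n.-tuple R :=
  [tuple if (i <= t)%N then tnth (Y x) i else 0 | i < n].

Lemma tnth_truncY t x i :
  tnth (truncY t x) i = if (i <= t)%N then tnth (Y x) i else 0.
Proof. exact: tnth_mktuple. Qed.

Lemma truncY_depends T t (h : n.-tuple R -> T) x :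
  depends_below t.+1 h -> h (truncY t x) = h (Y x).
Proof. by apply=> i; rewrite ltnS tnth_truncY => ->. Qed.

Lemma upd_truncY_depends T t (h : n.-tuple R -> T) x u :
  depends_below t.+1 h -> h (upd (truncY t x) t u) = h (upd (Y x) t u).
Proof.
by apply=> i; rewrite ltnS !tnth_upd; case: eqP => // _; rewrite tnth_truncY => ->.
Qed.

(** Coordinates beyond [t] are the constant 0, and an earlier [Y_i] equals [U_{i,b}] on the event
    [w_i = b], which gives a finite union of cylinders. *)
Lemma hist_rect t (A : 'I_n -> set R) : (forall i, measurable (A i)) ->
  <<s hist_events t >>
    [set x | forall i, i != t -> A i (tnth (truncY t x) i)].
Proof.
(* [G] is the sample space with the sigma-algebra of the past, so that the general lemmas on finite
   quantifiers apply to it. *)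
move=> mA; pose G : measurableType _ := g_sigma_algebraType (hist_events t).
apply: (@measurable_forall_fin _ G _
  (fun i => [set x | i != t -> A i (tnth (truncY t x) i)])) => i.
have [->|it] := eqVneq i t.
  by rewrite [X in measurable X](_ : _ = setT)//; apply/seteqP; split.
have [lit|] := boolP (i <= t)%N; last first.
  move=> nit; have [A0|A0] := pselect (A i 0).
    rewrite [X in measurable X](_ : _ = setT)//; apply/seteqP; split=> // x _ _.
    by rewrite tnth_mktuple (negbTE nit).
  rewrite [X in measurable X](_ : _ = set0)//; apply/seteqP; split=> // x.
  by move=> /(_ isT); rewrite tnth_mktuple (negbTE nit).
have ltit : (i < t)%N.
  by rewrite ltn_neqAle lit andbT; apply: contra it => /eqP/val_inj ->.
rewrite [X in measurable X](_ : _ =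
    [set x | exists b, w i x = b /\ A i (xi i x b)]); last first.
  apply/seteqP; split=> x /=; rewrite !tnth_mktuple lit.
    by move=> /(_ isT) Ax; exists (w i x).
  by move=> [b [<-]].
apply: (@measurable_exists_fin _ G) => b.
apply: sub_sigma_algebra.
exists (fun j => if j == i then [set b] else setT),
  (fun j a => if (j == i) && (a == b) then A i else setT), (fun _ _ => setT).
split=> //; first by move=> j a; case: ifP.
apply/seteqP; split=> x /=.
  move=> [wb Ax] j; split=> // jt; split; first by case: eqP => [->|].
  by move=> a; case: ifP => // /andP[/eqP -> /eqP ->].
move=> /(_ i)[_ /(_ ltit)[]]; rewrite eqxx /= => wb.
by move=> /(_ b); rewrite eqxx.
Qed.

Lemma measurable_truncY t : measurable_fun setT (truncY t).
Proof.
apply/measurable_fun_tnthP => i _ D mD; rewrite setTI.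
rewrite [X in measurable X](_ : _ =
  [set x | D (if (i <= t)%N then tnth (Y x) i else 0)]).
  case: leqP => _; first exact: measurable_Y_event.
  have [D0|D0] := pselect (D 0).
    by rewrite [X in measurable X](_ : _ = setT)//; apply/seteqP; split.
  by rewrite [X in measurable X](_ : _ = set0)//; apply/seteqP; split.
by apply/funext => x /=; rewrite tnth_truncY.
Qed.


(** Separates the constraint on the present from those on the past. The maps [Z] and [V] are general
    to cover both a fresh uniform and an entry of [xi_t]. *)
Lemma upd_rectE t (T : Type) (Z : T -> Omega) (V : T -> R) (A : 'I_n -> set R) :
  (fun z => upd (truncY t (Z z)) t (V z)) @^-1` rect A =
  Z @^-1` [set x | forall i, i != t -> A i (tnth (truncY t x) i)] `&`
  [set z | A t (V z)].
Proof.
apply/seteqP; split=> z; rewrite /rect /=.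
  move=> Az; split.
    by move=> i /negbTE it; have := Az i; rewrite tnth_upd it.
  by have := Az t; rewrite tnth_upd eqxx.
move=> [Az At] i; rewrite tnth_upd; case: eqP => [->//|/eqP].
exact: Az.
Qed.

Lemma measurable_upd_truncY t d' (T' : measurableType d')
    (Z : T' -> Omega) (V : T' -> R) :
  measurable_fun setT Z -> measurable_fun setT V ->
  measurable_fun setT (fun z => upd (truncY t (Z z)) t (V z)).
Proof.
move=> mZ mV; exact: (measurableT_comp (measurable_upd t)
  (measurable_fun_pair (measurableT_comp (measurable_truncY t) mZ) mV)).
Qed.

(** * Replacing the present statistic by a fresh uniform *)

Definition resample t (h : n.-tuple R -> \bar R) : \bar R :=
  (\int[Pr]_x \int[unif01]_u h (upd (Y x) t u))%E.

Section resample.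
Variables (t : 'I_n) (h : n.-tuple R -> \bar R).
Hypotheses (mh : measurable_fun setT h) (h0 : forall y, (0 <= h y)%E).
Hypothesis dh : depends_below t.+1 h.

(** Truncation is harmless because [h] ignores coordinates beyond [t]; it makes the first factor
    depend on the past alone, as the independence lemmas demand. *)
Lemma resampleE : resample t h =
  (\int[Pr \x unif01]_z h (upd (truncY t z.1) t z.2))%E.
Proof.
rewrite fubini_tonelli1//=.
  apply: eq_integral => x _; apply: eq_integral => u _.
  by rewrite upd_truncY_depends.
apply: (measurableT_comp mh).
exact: (@measurable_upd_truncY t).
Qed.

Let prod_rectE A : (forall i, measurable (A i)) ->
  ((Pr \x unif01) ((fun z => upd (truncY t z.1) t z.2) @^-1` rect A) =
   Pr [set x | forall i, i != t -> A i (tnth (truncY t x) i)] * unif01 (A t))%E.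
Proof.
move=> mA; have mH := hist_measurable (@hist_rect t A mA).
rewrite (upd_rectE t fst snd).
rewrite (_ : _ `&` _ = [set x | forall i, i != t -> A i (tnth (truncY t x) i)] `*` A t)//.
by rewrite [LHS]product_measure1E.
Qed.

Lemma integral_ncoin :
  (\int[Pr]_(x in [set x | ~~ B t x]) h (Y x) = (1 - e)%:E * resample t h)%E.
Proof.
have mF := @measurable_upd_truncY t _ (Omega * R)%type fst snd
  measurable_fst measurable_snd.
rewrite resampleE -(@ge0_integral_eq_rect _ _ _ _ _ _ Pr (Pr \x unif01)%E
  (truncY t) _ [set x | ~~ B t x] (1 - e) h _ _ mF)//.
- by apply: eq_integral => x _; rewrite truncY_depends.
- exact: measurable_ncoin.
- exact: measurable_truncY.
- by rewrite -ge0_fin_numE// fin_num_measure//; exact: measurable_ncoin.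
- by rewrite subr_ge0; case/andP: (coin_ge0_le1 t).
move=> A mA; rewrite [X in (_ * X)%E](prod_rectE mA).
rewrite -[RHS](ncoin_indep (mA t) (@hist_rect t A mA)).
rewrite setIA; congr (Pr (_ `&` _)).
have YtE x : tnth (Y x) t = tnth (truncY t x) t by rewrite tnth_truncY leqnn.
apply/seteqP; split=> x; rewrite /rect /=.
  by move=> Ax; split=> //; rewrite YtE.
move=> [Ax Atx] i; have [->|] := eqVneq i t; [by rewrite -YtE|exact: Ax].
Qed.

Lemma integral_coin_xi a :
  (\int[Pr]_(x in coin t) h (upd (Y x) t (xi t x a)) = e%:E * resample t h)%E.
Proof.
have mF := @measurable_upd_truncY t _ (Omega * R)%type fst snd
  measurable_fst measurable_snd.
rewrite resampleE -(@ge0_integral_eq_rect _ _ _ _ _ _ Pr (Pr \x unif01)%E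
  (fun x => upd (truncY t x) t (xi t x a)) _ (coin t) e h _ _ mF)//.
- by apply: eq_integral => x _; rewrite upd_truncY_depends.
- exact: measurable_coin.
- by apply: (@measurable_upd_truncY t) => //; exact: (wm_xi_meas hm).
- by rewrite -ge0_fin_numE// fin_num_measure//; exact: measurable_coin.
- by case/andP: (coin_ge0_le1 t).
move=> A mA; rewrite [X in (_ * X)%E](prod_rectE mA).
rewrite -[RHS](coin_indep a (mA t) (@hist_rect t A mA)).
by rewrite (upd_rectE t id) -setIA.
Qed.

(** Whatever token is chosen, [h (Y x)] is one of the [#|W|] nonnegative values obtained by writing
    some [U_{t,a}] at coordinate [t], hence at most their sum. Each term has a fixed letter, so
    [integral_coin_xi] computes its integral. *)
Lemma integral_coin_le :
  (\int[Pr]_(x in coin t) h (Y x) <= (#|W|%:R * e)%:E * resample t h)%E.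
Proof.
have mhx a : measurable_fun (coin t) (fun x => h (upd (Y x) t (xi t x a))).
  apply: measurable_funTS; apply: (measurableT_comp mh).
  exact: (measurableT_comp (measurable_upd t)
    (measurable_fun_pair measurable_Yvec (wm_xi_meas hm t a))).
apply: (@le_trans _ _
  (\int[Pr]_(x in coin t) \sum_(a : W) h (upd (Y x) t (xi t x a)))%E).
  apply: ge0_le_integral => //.
  - exact: measurable_coin.
  - by apply: measurable_funTS; apply: (measurableT_comp mh); exact: measurable_Yvec.
  - exact: emeasurable_sum.
  move=> x _; rewrite (bigD1 (w t x))//=.
  have {1}-> : Y x = upd (Y x) t (xi t x (w t x)).
    by rewrite -[xi t x _](tnth_mktuple (fun t => xi t x (w t x))) upd_id.
  by rewrite leeDl// sume_ge0.
rewrite ge0_integral_sum//; last exact: measurable_coin.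
rewrite (eq_bigr (fun=> (1%:E * (e%:E * resample t h))%E)); last first.
  by move=> a _; rewrite mul1e; exact: integral_coin_xi.
by rewrite -ge0_sume_distrl// sumEFin sumr_const EFinM muleA.
Qed.

End resample.

Lemma integral_coin_indep t h : measurable_fun setT h -> (forall y, (0 <= h y)%E) ->
  depends_below t h ->
  (\int[Pr]_(x in coin t) h (Y x) = e%:E * \int[Pr]_x h (Y x))%E.
Proof.
move=> mh h0 dh.
have dh' : depends_below t.+1 h.
  by move=> y y' yy'; apply: dh => i it; apply: yy'; rewrite ltnS ltnW.
(* Any letter would do, since [h] does not see coordinate [t]; [w t point] supplies one and thereby
   shows that [W] is inhabited. *)
have := integral_coin_xi mh h0 dh' (w t point).
under eq_integral do rewrite (depends_below_upd _ _ _ dh)//.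
move=> ->; congr (_ * _)%E; apply: eq_integral => x _.
under eq_integral do rewrite (depends_below_upd _ _ _ dh)//.
by rewrite integral_cst// [X in (_ * X)%E]probability_setT mule1.
Qed.

End model.

(** * The concave potential *)

Section potential.
Context {R : realType}.
Implicit Types c e delta K g b : R.

Definition phi c b : R := b - c * b ^+ 2.

Lemma phi_ge0 c b : 0 <= c <= 1 -> 0 <= b <= 1 -> 0 <= phi c b.
Proof. by rewrite /phi => ? ?; nra. Qed.

(** The difference [phi c g - phi c b] factors as [(g - b) * (1 - c * (g + b))], and the second
    factor lies in the unit interval. *)
Lemma phi_lipschitz c g b : 0 <= c <= 1 / 2 -> 0 <= g <= 1 -> 0 <= b <= 1 ->
  phi c g <= phi c b + `|g - b|.
Proof.
move=> c0 g0 b0; rewrite /phi.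
have gbc : 0 <= c * (g + b) <= 1 by nra.
rewrite -subr_ge0; case: (ger0P (g - b)) => gb.
  by have := mulr_ge0 gb (andP gbc).1; nra.
have : 0 <= (b - g) * (1 - c * (g + b)) by apply: mulr_ge0; lra.
by nra.
Qed.

(* The tangent to [phi c] at [b] is affine in [g], so it integrates exactly when
   [b] is the mean of [g]; the gap [c (g - b)^2] absorbs the deviation term. *)
Lemma phi_tangent c e delta K g b : 0 < c -> e < 1 ->
  (K * e) ^+ 2 <= 4 * c * (1 - e) * delta ->
  (1 - e) * phi c g + K * e * `|g - b| <=
  (1 - e) * (1 - 2 * c * b) * g + ((1 - e) * c * b ^+ 2 + delta).
Proof.
move=> c0 e1 hd; set x := `|g - b|.
have -> : phi c g = (1 - 2 * c * b) * g + c * b ^+ 2 - c * x ^+ 2.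
  by rewrite /x real_normK ?num_real// /phi; ring.
set s := (1 - e) * c; have s0 : 0 < s by rewrite /s; nra.
suff : K * e * x <= s * x ^+ 2 + delta by rewrite /s; nra.
rewrite -(ler_pM2l s0) -(ler_pM2l (ltr0n R 4)).
(* AM-GM as a square; the hypothesis bounds [(K * e) ^+ 2] by [4 * s * delta]. *)
have : 0 <= (2 * s * x - K * e) ^+ 2 by exact: sqr_ge0.
by rewrite /s in hd *; nra.
Qed.

Lemma measurable_phi d (T : measurableType d) c (f : T -> R) :
  measurable_fun setT f -> measurable_fun setT (fun x => phi c (f x)).
Proof.
move=> mf; apply: measurable_funB => //; apply: measurable_funM => //.
exact: measurable_funX.
Qed.

End potential.

(** * One step of the potential and its iteration *)

Section step.
Context {R : realType} {W : finType} {d : measure_display}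
  {Omega : measurableType d} {Pr : probability Omega R} {n : nat} {e : R}
  {P xi : 'I_n -> Omega -> W -> R} {w : 'I_n -> Omega -> W}
  {B : 'I_n -> Omega -> bool}.
Hypothesis hm : watermark_model Pr e P xi w B.
Variables (c delta : R).
Hypotheses (c0 : 0 < c) (c12 : c <= 1 / 2) (e1 : e < 1) (delta0 : 0 <= delta).
Hypothesis hdelta : (#|W|%:R * e) ^+ 2 <= 4 * c * (1 - e) * delta.

Local Notation Y := (Yvec xi w).
Local Notation resample := (@resample _ _ _ _ Pr _ xi w).

Lemma resample_lin (t : 'I_n) (f g : n.-tuple R -> R) (k l : R) :
  measurable_fun setT f -> measurable_fun setT g ->
  (forall y, 0 <= f y) -> (forall y, 0 <= g y) ->
  depends_below t.+1 f -> depends_below t.+1 g -> 0 <= k -> 0 <= l ->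
  (k%:E * resample t (EFin \o f) + l%:E * resample t (EFin \o g) =
   resample t (fun y => (k * f y + l * g y)%:E))%E.
Proof.
move=> mf mg f0 g0 df dg k0 l0.
have mF := @measurable_upd_truncY _ _ _ _ _ _ _ _ _ _ _ hm t _ (Omega * R)%type
  fst snd measurable_fst measurable_snd.
have mfE : measurable_fun setT (EFin \o f) by exact/measurable_EFinP.
have mgE : measurable_fun setT (EFin \o g) by exact/measurable_EFinP.
have f0E y : (0 <= (EFin \o f) y)%E by rewrite lee_fin.
have g0E y : (0 <= (EFin \o g) y)%E by rewrite lee_fin.
have dfE : depends_below t.+1 (EFin \o f) by move=> y y' yy' /=; rewrite (df y y').
have dgE : depends_below t.+1 (EFin \o g) by move=> y y' yy' /=; rewrite (dg y y').
rewrite (resampleE hm mfE f0E dfE) (resampleE hm mgE g0E dgE).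
rewrite (resampleE hm); first last.
- by move=> y y' yy'; rewrite (df y y') ?(dg y y').
- by move=> y; rewrite lee_fin addr_ge0// mulr_ge0.
- by apply/measurable_EFinP; apply: measurable_funD; apply: measurable_funM.
have mfF := measurableT_comp mfE mF.
have mgF := measurableT_comp mgE mF.
rewrite -ge0_integralZl_EFin// -ge0_integralZl_EFin// -ge0_integralD//.
- by move=> z _; rewrite mule_ge0.
- exact: measurable_funeM.
- by move=> z _; rewrite mule_ge0.
- exact: measurable_funeM.
Qed.

(** Split on the coin. Without it the present is a fresh uniform. With it, [phi c h] is at most
    [phi c b + |h - b|]: the first term is independent of the coin, the second costs at most
    [#|W| * e] times its resampled mean. The resampled terms are then bounded together by
    [phi_tangent]. *)
Lemma phi_step (t : 'I_n) (h : n.-tuple R -> R) :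
  measurable_fun setT h -> (forall y, 0 <= h y <= 1) -> depends_below t.+1 h ->
  (\int[Pr]_x (phi c (h (Y x)))%:E <=
   \int[Pr]_x (phi c (avg t h (Y x)))%:E + delta%:E)%E.
Proof.
move=> mh h01 dh; set b := avg t h.
have /andP[e0 _] := coin_ge0_le1 hm t.
have c02 : 0 <= c <= 1 / 2 by rewrite (ltW c0) c12.
have c01 : 0 <= c <= 1 by case/andP: c02 => -> c2 /=; apply: le_trans c2 _; lra.
have mb : measurable_fun setT b by exact: measurable_avg.
have b01 y : 0 <= b y <= 1 by exact: avg_ge0_le1.
have db : depends_below t b by exact: depends_below_avg.
have db' : depends_below t.+1 b.
  by move=> y y' yy'; apply: db => i it; apply: yy'; rewrite ltnS ltnW.
pose G y := `|h y - b y|.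
have G0 y : 0 <= G y by exact: normr_ge0.
have mG : measurable_fun setT G.
  by apply: measurableT_comp => //; exact: measurable_funB.
have dG : depends_below t.+1 G.
  by move=> y y' yy'; rewrite /G (dh y y')// (db' y y').
have mF : measurable_fun setT (fun y => phi c (h y)) by exact: measurable_phi.
have dF : depends_below t.+1 (fun y => phi c (h y)).
  by move=> y y' yy'; rewrite (dh y y').
have F0 y : 0 <= phi c (h y) by exact: phi_ge0.
have mPb : measurable_fun setT (fun y => phi c (b y)) by exact: measurable_phi.
have Pb0 y : 0 <= phi c (b y) by exact: phi_ge0.
have mY : measurable_fun setT Y by exact: (measurable_Yvec hm).
have mcoin := measurable_coin hm t; have mncoin := measurable_ncoin hm t.
have mE (f : n.-tuple R -> R) (D : set Omega) : measurable_fun setT f ->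
    measurable_fun D (fun x => (f (Y x))%:E).
  by move=> mf; apply/measurable_EFinP/measurable_funTS; exact: (measurableT_comp mf).
pose I := (\int[Pr]_x (phi c (b (Y x)))%:E)%E; rewrite -/I.
have I0 : (0 <= I)%E by apply: integral_ge0 => x _; rewrite lee_fin.
have coinT : [set x | B t x] `|` [set x | ~~ B t x] = setT.
  by apply/seteqP; split=> // x _ /=; case: (B t x); [left|right].
rewrite -[X in (\int[_]_(_ in X) _ <= _)%E]coinT ge0_integral_setU//; last 3 first.
- exact: mE mF.
- by move=> x _; rewrite lee_fin.
- by apply/disj_setPS => x [/= ->].
have -> : (\int[Pr]_(x in [set x | ~~ B t x]) (phi c (h (Y x)))%:E =
    (1 - e)%:E * resample t (EFin \o (fun y => phi c (h y))))%E.
  apply: (integral_ncoin hm (h := EFin \o (fun y => phi c (h y)))) => //.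
  - exact/measurable_EFinP.
  - by move=> y y' yy' /=; rewrite (dh y y').
have coinle : (\int[Pr]_(x in [set x | B t x]) (phi c (h (Y x)))%:E <=
    e%:E * I + (#|W|%:R * e)%:E * resample t (EFin \o G))%E.
  apply: (@le_trans _ _
      (\int[Pr]_(x in [set x | B t x]) ((phi c (b (Y x)))%:E + (G (Y x))%:E))%E).
    apply: ge0_le_integral => //.
    - by move=> x _; rewrite lee_fin.
    - exact: mE mF.
    - by apply: emeasurable_funD; [exact: mE mPb|exact: mE mG].
    - by move=> x _; rewrite -EFinD lee_fin; exact: phi_lipschitz.
  rewrite ge0_integralD//; do ?[exact: mE mPb|exact: mE mG|by move=> x _; rewrite lee_fin].
  apply: leeD.
    rewrite (integral_coin_indep hm (h := EFin \o (fun y => phi c (b y))))//.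
    - exact/measurable_EFinP.
    - by move=> y y' yy' /=; rewrite (db y y').
  apply: (integral_coin_le hm (h := EFin \o G)) => //.
  - exact/measurable_EFinP.
  - by move=> y y' yy' /=; rewrite (dG y y').
apply: (le_trans (leeD2r _ coinle)); rewrite -addeA.
have Ke0 : 0 <= #|W|%:R * e by rewrite mulr_ge0.
have e1' : 0 <= 1 - e by rewrite subr_ge0 ltW.
(* The share [e * I] contributed by the coin cancels, leaving [(1 - e) * I + delta] to dominate the
   resampled terms. *)
have -> : (I + delta%:E = e%:E * I + ((1 - e)%:E * I + delta%:E))%E.
  by rewrite addeA -ge0_muleDl ?lee_fin// -EFinD (addrC e) subrK mul1e.
apply: leeD2l; rewrite addeC resample_lin//.
have mS : measurable_fun setT (fun y => (1 - e) * phi c (h y) + #|W|%:R * e * G y).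
  by apply: measurable_funD; apply: measurable_funM.
have S0 y : 0 <= (1 - e) * phi c (h y) + #|W|%:R * e * G y.
  by rewrite addr_ge0// mulr_ge0.
have -> : ((1 - e)%:E * I + delta%:E =
    \int[Pr]_x ((1 - e)%:E * (phi c (b (Y x)))%:E + delta%:E))%E.
  rewrite ge0_integralD//; last 2 first.
  - by move=> x _; rewrite -EFinM lee_fin mulr_ge0.
  - by apply: measurable_funeM; exact: mE mPb.
  rewrite ge0_integralZl_EFin//; [|by move=> x _; rewrite lee_fin|exact: mE mPb].
  by rewrite integral_cst// [X in (_ + _ * X)%E]probability_setT mule1.
apply: ge0_le_integral => //.
- by move=> x _; apply: integral_ge0 => u _; rewrite lee_fin.
- apply: (@measurable_fun_fubini_tonelli_F _ _ _ _ _ unif01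
    (fun z : Omega * R => ((1 - e) * phi c (h (upd (Y z.1) t z.2)) +
      #|W|%:R * e * G (upd (Y z.1) t z.2))%:E)).
    apply/measurable_EFinP; apply: (measurableT_comp mS).
    exact: (measurableT_comp (measurable_upd t)
      (measurable_fun_pair (measurableT_comp mY measurable_fst) measurable_snd)).
  by move=> z; rewrite lee_fin.
- by apply: emeasurable_funD => //; apply: measurable_funeM; exact: mE mPb.
move=> x _; set bx := b (Y x).
have mhu : measurable_fun setT (fun u => h (upd (Y x) t u)).
  exact: (measurableT_comp mh (measurable_upd_r t (Y x))).
have k0 : 0 <= (1 - e) * (1 - 2 * c * bx).
  by rewrite mulr_ge0//; have := b01 (Y x); rewrite -/bx; nra.
have l0 : 0 <= (1 - e) * c * bx ^+ 2 + delta.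
  by rewrite addr_ge0// mulr_ge0 ?sqr_ge0// mulr_ge0// ltW.
apply: (@le_trans _ _ (\int[unif01]_u
  (((1 - e) * (1 - 2 * c * bx))%:E * (h (upd (Y x) t u))%:E +
   ((1 - e) * c * bx ^+ 2 + delta)%:E))%E).
  apply: ge0_le_integral => //.
  - by move=> u _; rewrite lee_fin.
  - apply/measurable_EFinP; apply: (measurableT_comp mS).
    exact: measurable_upd_r.
  - by apply: emeasurable_funD => //; apply: measurable_funeM; exact/measurable_EFinP.
  move=> u _; rewrite -EFinM -EFinD lee_fin /G.
  (* The tangent point [bx] is the same for all [u], since [avg t h] ignores coordinate [t]. *)
  rewrite (depends_below_upd _ _ (leqnn t) db) -/bx.
  exact: phi_tangent.
rewrite ge0_integralD//; last 2 first.
- by move=> u _; rewrite -EFinM lee_fin mulr_ge0//; case/andP: (h01 (upd (Y x) t u)).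
- by apply: measurable_funeM; exact/measurable_EFinP.
rewrite ge0_integralZl_EFin//; [|move=> u _; rewrite lee_fin
  |exact/measurable_EFinP]; last by case/andP: (h01 (upd (Y x) t u)).
(* As [bx] is the mean of [h] over [u], the affine bound integrates to
   [(1 - e) * phi c bx + delta]. *)
rewrite integral_cst// [X in (_ + _ * X)%E]probability_setT mule1 -avgE// -/b -/bx.
by rewrite -!EFinM -!EFinD lee_fin /phi; nra.
Qed.

(** Averaging out the last visible coordinate costs [delta] by [phi_step] and preserves the mean
    under [Q] by [integral_avg]. *)
Lemma phi_bound (Q : probability (n.-tuple R) R) (k : nat) (h : n.-tuple R -> R) :
  iid_uniform Q -> (k <= n)%N ->
  measurable_fun setT h -> (forall y, 0 <= h y <= 1) -> depends_below k h ->
  (\int[Pr]_x (phi c (h (Y x)))%:E <=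
   (phi c (fine (\int[Q]_y (h y)%:E)) + k%:R * delta)%:E)%E.
Proof.
move=> iidQ; elim: k h => [|k IH] h kn mh h01 dh.
  (* With no visible coordinate [h] is constant, so any point gives its value. *)
  pose v := h (Y point).
  have hv y : h y = v by exact: dh.
  rewrite (eq_integral (fun=> (phi c v)%:E)); last by move=> x _; rewrite hv.
  rewrite [in leRHS](eq_integral (fun=> v%:E)); last by move=> y _; rewrite hv.
  rewrite !integral_cst// [X in (_ * X <= _)%E]probability_setT.
  by rewrite [X in fine (_ * X)%E]probability_setT !mule1 mul0r addr0.
pose t := Ordinal kn.
have mb : measurable_fun setT (avg t h) by exact: measurable_avg.
have b01 y : 0 <= avg t h y <= 1 by exact: avg_ge0_le1.
have db : depends_below k (avg t h) by exact: (@depends_below_avg _ _ t).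
apply: le_trans (@phi_step t h mh h01 dh) _.
apply: le_trans (leeD2r _ (IH _ (ltnW kn) mb b01 db)) _.
by rewrite integral_avg// -EFinD lee_fin -natr1 mulrDl mul1r addrA.
Qed.

(** On an indicator [phi c] is multiplication by [1 - c]. With [p] and [q] the two probabilities
    this gives [(1 - c) * p <= q - c * q ^+ 2 + n * delta], and [c * p <= c]. *)
Lemma prob_sub_le (Q : probability (n.-tuple R) R) (A : set (n.-tuple R)) :
  iid_uniform Q -> measurable A ->
  fine (Pr (Y @^-1` A)) - fine (Q A) <= c + n%:R * delta.
Proof.
move=> iidQ mA.
have mYA : measurable (Y @^-1` A) by exact: (measurable_Y_preimage hm).
have mh : measurable_fun setT (\1_A : n.-tuple R -> R) by exact: measurable_indic.
have h01 y : 0 <= (\1_A y : R) <= 1.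
  by rewrite indicE; case: (y \in A); rewrite ?ler01 ?lexx.
have dh : depends_below n (\1_A : n.-tuple R -> R).
  by move=> y y' yy'; congr (\1_A _); apply: eq_from_tnth => i; exact: yy'.
have := phi_bound iidQ (leqnn n) mh h01 dh.
rewrite integral_indic// setIT.
rewrite (eq_integral (fun x => ((1 - c)%:E * (\1_(Y @^-1` A) x)%:E)%E)); last first.
  move=> x _; rewrite -EFinM /phi !indicE.
  rewrite (_ : (x \in Y @^-1` A) = (Y x \in A)); last by apply/idP/idP; rewrite !inE.
  by case: (Y x \in A) => /=; congr EFin; ring.
rewrite ge0_integralZl_EFin//; last 2 first.
- by apply/measurable_EFinP; exact: measurable_indic.
- by rewrite subr_ge0 (le_trans c12)//; lra.
rewrite integral_indic// setIT.
have fP : Pr (Y @^-1` A) \is a fin_num by exact: fin_num_measure.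
rewrite -[X in (_ * X)%E](fineK fP) -EFinM lee_fin /phi.
set p := fine (Pr _); set q := fine (Q A).
have : 0 <= p <= 1.
  by rewrite -!lee_fin /p fineK// measure_ge0 probability_le1.
by have := mulr_ge0 (ltW c0) (sqr_ge0 q); have := c0; nra.
Qed.

End step.

(** * Rates *)

(** The one-sided bound for [A] and for its complement gives the absolute value. *)
Lemma prob_dist_le (R : realType) (W : finType) d (Omega : measurableType d)
    (Pr : probability Omega R) (n : nat) (e c : R)
    (P xi : 'I_n -> Omega -> W -> R) (w : 'I_n -> Omega -> W)
    (B : 'I_n -> Omega -> bool) (Q : probability (n.-tuple R) R)
    (A : set (n.-tuple R)) :
  watermark_model Pr e P xi w B -> iid_uniform Q ->
  0 < c <= 1 / 2 -> e <= 1 / 2 -> measurable A ->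
  (`|Q A - Pr (Yvec xi w @^-1` A)| <=
    (c + n%:R * ((#|W|%:R * e) ^+ 2 / (2 * c)))%:E)%E.
Proof.
move=> hm iidQ /andP[c0 c12] e12 mA.
(* Since [e <= 1 / 2], one has [4 * c * (1 - e) >= 2 * c], so this [delta] meets the condition of
   [phi_tangent]. *)
set delta := (#|W|%:R * e) ^+ 2 / (2 * c).
have c2 : 0 < 2 * c by rewrite mulr_gt0.
have delta0 : 0 <= delta by rewrite divr_ge0 ?sqr_ge0// ltW.
have e1 : e < 1 by apply: le_lt_trans e12 _; lra.
have hdelta : (#|W|%:R * e) ^+ 2 <= 4 * c * (1 - e) * delta.
  have -> : 4 * c * (1 - e) * delta = (#|W|%:R * e) ^+ 2 * (2 * (1 - e)).
    by rewrite /delta; field; rewrite gt_eqF.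
  by rewrite ler_peMr ?sqr_ge0//; lra.
have le E := prob_sub_le hm c0 c12 e1 delta0 hdelta (A := E) iidQ.
have mYA : measurable (Yvec xi w @^-1` A) by exact: (measurable_Y_preimage hm).
have fQ : Q A \is a fin_num by exact: fin_num_measure.
have fP : Pr (Yvec xi w @^-1` A) \is a fin_num by exact: fin_num_measure.
have := le _ mA; have := le _ (measurableC mA).
rewrite preimage_setC [X in fine X - _](probability_setC _ mYA).
rewrite [X in _ - fine X](probability_setC _ mA).
rewrite -(fineK fQ) -(fineK fP) -EFinB abse_EFin lee_fin ler_norml.
set q := fine (Q A); set p := fine (Pr _).
rewrite -!EFinB /= => h2 h1; apply/andP; split; lra.
Qed.

Lemma cvg_powR_nat (R : realType) (s : R) : 0 < s ->
  (n%:R `^ (- s) : R) @[n --> \oo] --> 0.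
Proof.
(* The shift avoids [n = 0] and turns the sequence into the power [s] of [1 / (n + 1)], which tends
   to 0 from the right. *)
move=> s0; rewrite -cvg_shiftS.
rewrite [X in X @ _ --> _](_ : _ = (fun n => harmonic n `^ s)); last first.
  by apply/funext => n; rewrite /= -powR_inv1// -powRrM mulN1r.
have /cvg_at_rightP pow0 := powR_cvg0 s0; apply: (pow0 harmonic).
by split; [move=> n; exact: harmonic_gt0|exact: cvg_harmonic].
Qed.

(** Take [c = q = n^(1/2 - p)] and [r = n^(-1/2)]. Then [n^(-p) = q * r] and [n * r^2 = 1], so
    [n * e^2 / q] is at most [C^2 * q]: both error terms have order [q]. *)
Lemma prob_dist_rate (R : realType) (W : finType) (p C : R) (n : nat) (e : R)
    d (Omega : measurableType d) (Pr : probability Omega R)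
    (P xi : 'I_n -> Omega -> W -> R) (w : 'I_n -> Omega -> W)
    (B : 'I_n -> Omega -> bool) (Q : probability (n.-tuple R) R)
    (A : set (n.-tuple R)) :
  watermark_model Pr e P xi w B -> iid_uniform Q -> (0 < n)%N ->
  n%:R `^ (- (p - 1 / 2)) <= 1 / 2 ->
  C * n%:R `^ (- (p - 1 / 2)) <= 1 / 2 ->
  0 <= C -> 0 <= e <= C * n%:R `^ (- p) -> measurable A ->
  (`|Q A - Pr (Yvec xi w @^-1` A)| <=
    ((1 + (#|W|%:R * C) ^+ 2 / 2) * n%:R `^ (- (p - 1 / 2)))%:E)%E.
Proof.
move=> hm iidQ n0; set q := _ `^ (- (p - _)) => q12 Cq12 C0 /andP[e0 eC] mA.
have n0R : (0 : R) < n%:R by rewrite ltr0n.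
have q0 : 0 < q by exact: powR_gt0.
pose r : R := n%:R `^ (- (1 / 2)).
have r0 : 0 < r by exact: powR_gt0.
have qrE : n%:R `^ (- p) = q * r.
  rewrite -powRD; last by rewrite (gt_eqF n0R) implybT.
  by congr (_ `^ _); field.
have rrE : n%:R * r ^+ 2 = 1.
  rewrite expr2 -powRD; last by rewrite (gt_eqF n0R) implybT.
  rewrite (_ : - (1 / 2) + - (1 / 2) = -1 :> R); last by field.
  by rewrite powR_inv1 ?ler0n// mulfV// gt_eqF.
have r1 : r <= 1.
  have n1 : (1 : R) <= n%:R by rewrite ler1n.
  by rewrite leNgt; apply/negP => r1; nra.
have eqr : e <= C * q * r by rewrite -mulrA -qrE.
have Cq0 : 0 <= C * q by rewrite mulr_ge0// ltW.
have e12 : e <= 1 / 2.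
  by apply: (le_trans eqr); apply: le_trans Cq12; exact: ler_piMr.
apply: (le_trans (prob_dist_le hm iidQ (c := q) _ e12 mA)); first by rewrite q0.
rewrite lee_fin [leRHS]mulrDl mul1r lerD2l mulrA ler_pdivrMr; last by rewrite mulr_gt0.
have -> : (#|W|%:R * C) ^+ 2 / 2 * q * (2 * q) =
    n%:R * (#|W|%:R * (C * q * r)) ^+ 2.
  transitivity (n%:R * r ^+ 2 * (#|W|%:R * C * q) ^+ 2); last by ring.
  by rewrite rrE; field.
have We0 : 0 <= #|W|%:R * e by rewrite mulr_ge0.
have WCqr0 : 0 <= #|W|%:R * (C * q * r) by rewrite mulr_ge0// mulr_ge0// ltW.
by rewrite ler_pM2l// ler_sqr ?nnegrE// ler_wpM2l.
Qed.

Theorem theorem4p1 (R : realType) (W : finType) (p : R)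
  (hp : 1 / 2 < p <= 1) (eps : nat -> R)
  (heps : exists C1 C2 : R, 0 < C1 /\ 0 < C2 /\
     forall n : nat, (0 < n)%N ->
       C1 * n%:R `^ (- p) <= eps n <= C2 * n%:R `^ (- p))
  (d : nat -> measure_display) (Omega : forall n, measurableType (d n))
  (Pr : forall n, probability (Omega n) R)
  (P xi : forall n, 'I_n -> Omega n -> W -> R)
  (w : forall n, 'I_n -> Omega n -> W)
  (B : forall n, 'I_n -> Omega n -> bool)
  (hmodel : forall n, watermark_model (Pr n) (eps n) (P n) (xi n) (w n) (B n))
  (Q0 : forall n, probability (n.-tuple R) R)
  (hQ0 : forall n, iid_uniform (Q0 n)) :
  (fun n => tv_dist (Q0 n) (Pr n) (Yvec (xi n) (w n))) @ \oo --> 0%E /\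
  (forall Arej : forall n, set (n.-tuple R), (forall n, measurable (Arej n)) ->
    (fun n => Q0 n (Arej n) + (1 - Pr n (Yvec (xi n) (w n) @^-1` Arej n)))%E
      @ \oo --> 1%E).
Proof.
have [C1 [C [C10 [C0 hC]]]] := heps.
have s0 : 0 < p - 1 / 2 by case/andP: hp => ? _; rewrite subr_gt0.
pose q n : R := n%:R `^ (- (p - 1 / 2)).
have q_cvg : q n @[n --> \oo] --> 0 by exact: cvg_powR_nat.
pose M := 1 + (#|W|%:R * C) ^+ 2 / 2.
have Mq_cvg : (M * q n) @[n --> \oo] --> 0.
  by rewrite -[X in _ --> X](mulr0 M); apply: cvgM => //; exact: cvg_cst.
have Cq_cvg : (C * q n) @[n --> \oo] --> 0.
  by rewrite -[X in _ --> X](mulr0 C); apply: cvgM => //; exact: cvg_cst.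
(* The rate is uniform in the event, so it serves the supremum as well as a test that varies with
   [n]. *)
have rate : \forall n \near \oo, forall A, measurable A ->
    (`|Q0 n A - Pr n (Yvec (xi n) (w n) @^-1` A)| <= (M * q n)%:E)%E.
  have half : (0 : R) < 1 / 2 by lra.
  near=> n; move=> A; apply: (prob_dist_rate (hmodel n)) => //.
  - by near: n; exists 1%N.
  - by apply: ltW; near: n; exact: cvgr_lt q_cvg _ half.
  - by apply: ltW; near: n; exact: cvgr_lt Cq_cvg _ half.
  - exact: ltW.
  - have n0 : (0 < n)%N by near: n; exists 1%N.
    (* The lower bound with [C1] provides [0 <= eps n]. *)
    case/andP: (hC n n0) => h1 ->; rewrite andbT; apply: le_trans h1.
    by rewrite mulr_ge0 ?powR_ge0// ltW.
split.
  apply: (@squeeze_cvge _ _ _ _ (fun=> 0%E) _ (fun n => (M * q n)%:E)).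
  - near=> n; apply/andP; split.
      (* The supremum is nonnegative because the empty event belongs to the family. *)
      apply: le_trans (_ : `|Q0 n set0 - Pr n (Yvec (xi n) (w n) @^-1` set0)| <= _)%E.
        exact: abse_ge0.
      by apply: ereal_sup_ubound; exists set0 => //; exact: measurable0.
    apply: ge_ereal_sup => _ [A mA <-].
    by move: A mA; near: n; exact: rate.
  - exact: cvg_cst.
  - by apply/fine_cvgP; split; [exact: nearW|].
move=> Arej mArej.
pose Pn n := Pr n (Yvec (xi n) (w n) @^-1` Arej n).
have QE n : Q0 n (Arej n) = (fine (Q0 n (Arej n)))%:E.
  by rewrite fineK// fin_num_measure//; exact: mArej.
have PE n : Pn n = (fine (Pn n))%:E.
  by rewrite fineK// fin_num_measure//; exact: (measurable_Y_preimage (hmodel n)).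
have sumE n : (Q0 n (Arej n) + (1 - Pn n) =
    (fine (Q0 n (Arej n)) + (1 - fine (Pn n)))%:E)%E.
  by rewrite [in LHS]QE [in LHS]PE.
apply/fine_cvgP; split; first by apply: nearW => n; rewrite sumE.
apply/cvgrPdist_le => eta eta0.
have Mq_eta : \forall n \near \oo, M * q n < eta by exact: cvgr_lt Mq_cvg _ eta0.
near=> n; rewrite /= sumE /=.
have : (`|Q0 n (Arej n) - Pn n| <= (M * q n)%:E)%E.
  by rewrite /Pn; move: (Arej n) (mArej n); near: n; exact: rate.
rewrite QE PE -EFinB abse_EFin lee_fin => le.
(* The sum of the two errors differs from 1 by exactly the difference of the two probabilities of
   the rejection region. *)
rewrite distrC (_ : _ - 1 = fine (Q0 n (Arej n)) - fine (Pn n)); last by ring.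
by apply: (le_trans le); apply: ltW; near: n.
Unshelve. all: by end_near. Qed.
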